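(* Let $f,g:[0,\infty)\to\mathbb{R}$ be continuous with $f(t)>0$ and $g(t)>0$ for all $t\ge0$, and let $\alpha<0$ and $T>0$. Put $F(t)=\exp\big(\int_0^t f(s)\,ds\big)$. Assume that $g$ is continuously differentiable and that $$g'(t)\le f(t)\,g(t)\qquad\text{for all } t .$$ Then for all $t_0\in(0,T)$ such that $$-\alpha-\frac{F(t_0)}{g(t_0)}\int_0^{t_0}\frac{g(t)^2}{F(t)^2}\,dt+\int_0^{t_0}\frac{g(t)}{F(t)}\,dt>0,$$ there is a weight $\gamma>0$ such that the support of the corresponding optimal control, i.e. the solution of the problem $$\mathbf{(OC)}_T:\quad \min_{u\in L^2(0,T),\ y\in AC(0,T)}\ \int_0^T \tfrac12|u(t)|^2+|u(t)|+\gamma\,|y(t)|\,dt$$ subject to $y(0)=\alpha$, $y'(t)=f(t)\,y(t)+g(t)\,u(t)$, $y(T)=0$, is contained in $[0,t_0]$.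
   Context: All functions are real-valued. $AC(0,T)$ denotes the absolutely continuous functions on $[0,T]$; the differential equation holds for almost every $t\in(0,T)$. *)

(* Defs.v *)
From HB Require Import structures.
From mathcomp Require Import all_boot all_order all_algebra.
From mathcomp Require Import all_classical all_reals all_analysis.

Set Implicit Arguments.
Unset Strict Implicit.
Unset Printing Implicit Defensive.

Import Order.TTheory GRing.Theory Num.Theory.
Import numFieldNormedType.Exports.

Local Open Scope classical_set_scope.
Local Open Scope ring_scope.

(* One-sided at the endpoints of D when D is an interval. *)
Definition has_derivative_within (R : realType) (D : set R) (g : R -> R)
    (t l : R) : Prop :=
  (g s - g t) / (s - t) @[s --> within D t^'] --> l.

Definition C1_on_with (R : realType) (D : set R) (g dg : R -> R) : Prop :=
  (forall t, D t -> has_derivative_within D g t (dg t)) /\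
  {within D, continuous dg}.

Definition absolutely_continuous (R : realType) (a b : R) (y : R -> R) : Prop :=
  forall e : R, 0 < e -> exists2 d : R, 0 < d &
    forall (n : nat) (l r : 'I_n -> R),
      (forall i, a <= l i /\ l i <= r i /\ r i <= b) ->
      trivIset setT (fun i => `]l i, r i[%classic) ->
      \sum_(i < n) (r i - l i) < d ->
      \sum_(i < n) `|y (r i) - y (l i)| < e.

Definition square_integrable (R : realType) (D : set R) (u : R -> R) : Prop :=
  u \_ D \in Lfun (@lebesgue_measure R) 2%:E.

(* The support of the class of u modulo null sets: the points having no
   neighbourhood on which u vanishes almost everywhere in D. *)
Definition ess_support (R : realType) (D : set R) (u : R -> R) : set R :=
  [set t | forall U : set R, nbhs t U ->
     ~ {ae @lebesgue_measure R, forall s, D s -> U s -> u s = 0}].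

Definition integrating_factor (R : realType) (f : R -> R) (t : R) : R :=
  expR (\int[lebesgue_measure]_(s in `[0, t]) f s).

Definition admissible (R : realType) (f g : R -> R) (alpha T : R)
    (u y : R -> R) : Prop :=
  [/\ square_integrable `]0, T[%classic u,
      absolutely_continuous 0 T y,
      y 0 = alpha,
      {ae @lebesgue_measure R, forall t, `]0, T[%classic t ->
         is_derive t (1 : R) y (f t * y t + g t * u t)}
    & y T = 0].

(* The integrand is nonnegative, so the cost is well defined in \bar R. *)
Definition cost (R : realType) (T gamma : R) (u y : R -> R) : \bar R :=
  (\int[@lebesgue_measure R]_(t in `]0%R, T[)
     (2^-1 * `|u t| ^+ 2 + `|u t| + gamma * `|y t|)%:E)%E.

Definition OC_solution (R : realType) (f g : R -> R) (alpha T gamma : R)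
    (u y : R -> R) : Prop :=
  admissible f g alpha T u y /\
  forall v z : R -> R, admissible f g alpha T v z ->
    (cost T gamma u y <= cost T gamma v z)%E.

(* Only the values of u almost everywhere on (0, T) and those of y on [0, T]
   are meaningful, so this is the sense in which solutions are unique. *)
Definition OC_unique_solution (R : realType) (f g : R -> R)
    (alpha T gamma : R) (u y : R -> R) : Prop :=
  OC_solution f g alpha T gamma u y /\
  forall v z : R -> R, OC_solution f g alpha T gamma v z ->
    {ae @lebesgue_measure R, forall t, `]0, T[%classic t -> v t = u t} /\
    (forall t, 0 <= t <= T -> z t = y t).

(* Main.v *)
(** Dividing the state by the integrating factor turns the equation into
    z' = w u with w = g / F, which is nonincreasing because g' <= f g.  Let
    P(t) = 1 / w(t0) + gamma * int_t^t0 F on [0, t0], extended by the constant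
    1 / w(t0) beyond t0, and u = (P w - 1)_+.  By monotonicity of w, u is
    nonnegative and vanishes beyond t0, and the hypothesis on t0 says exactly
    that the gamma > 0 for which u steers alpha to 0 exists.  Then z <= 0, and
    P is an adjoint state: for every admissible (v, Y), the integrand of the
    cost of (v, Y) is at least that of (u, y) plus (v - u)^2 / 2 plus the
    derivative of P (Y - y) / F, whose integral vanishes.  Since Y is only
    absolutely continuous, the last point rests on the fundamental theorem of
    calculus for such functions. *)

Require Import Defs.
From HB Require Import structures.
From mathcomp Require Import all_boot all_order all_algebra.
From mathcomp Require Import all_classical all_reals all_analysis.
From mathcomp Require Import measurable_realfun.
From mathcomp Require Import ring lra zify.

Import Order.TTheory GRing.Theory Num.Theory.
Import numFieldNormedType.Exports.

Local Open Scope classical_set_scope.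
Local Open Scope ring_scope.

Set Implicit Arguments.
Unset Strict Implicit.

(** * Absolutely continuous functions *)

(** Apply the step at the supremum [c] of the points of [[a, b]] where [G] holds: from such a point
    close to [c] it reaches [c] and, if [c < b], a point beyond [c]. *)
Lemma real_induction (R : realType) (a b : R) (G : R -> Prop) :
  a <= b -> G a ->
  (forall c, a <= c <= b -> exists2 eta : R, 0 < eta &
     forall x y, a <= x <= c -> c <= y <= b -> c - eta < x -> y < c + eta ->
       G x -> G y) ->
  G b.
Proof.
move=> ab Ga step.
pose S : set R := [set x | a <= x <= b /\ G x].
have Sa : S a by rewrite /S /= lexx ab.
have supS : has_sup S.
  by split; [exists a|exists b => x [/andP[]]].
pose c := sup S.
have ac : a <= c by apply: ub_le_sup => //; case: supS.
have cb : c <= b by apply: ge_sup; [exists a|move=> x [/andP[]]].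
have /step[eta eta0 Heta] : a <= c <= b by rewrite ac.
have [x [/andP[ax xb] Gx] cx] := sup_adherent eta0 supS.
have xc : x <= c by apply: ub_le_sup; [case: supS|split => //; rewrite ax].
have Gy y : c <= y <= b -> y < c + eta -> G y.
  by move=> cy yeta; apply: (Heta x y) => //; rewrite ?ax.
have [->|] := eqVneq b c; first by apply: Gy; rewrite ?lexx//; lra.
rewrite neq_lt => /orP[|cb']; first by lra.
pose y := Order.min b (c + eta / 2).
have [yb ye] : y <= b /\ y <= c + eta / 2 by rewrite /y !ge_min !lexx orbT.
have cy : c < y by rewrite /y lt_min cb' ltrDl divr_gt0.
have Syy : S y.
  split; first by rewrite yb (le_trans ac) // ltW.
  by apply: Gy; rewrite ?(ltW cy) ?yb//; lra.
have : y <= c by apply: ub_le_sup => //; case: supS.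
lra.
Qed.

Section absolutely_continuous_facts.
Context {R : realType}.
Notation mu := (@lebesgue_measure R).
Implicit Types (a b : R) (h : R -> R).

Lemma absolutely_continuousS a b a' b' h : a <= a' -> b' <= b ->
  absolutely_continuous a b h -> absolutely_continuous a' b' h.
Proof.
move=> aa bb ach e /ach[d d0 H]; exists d => // n l r lr.
apply: H => i; have [? [? ?]] := lr i.
by split; [exact: le_trans aa _|split=> //; exact: le_trans bb].
Qed.

Lemma absolutely_continuous_lipschitz a b h (M : R) :
  (forall s t, a <= s -> s <= t -> t <= b -> `|h t - h s| <= M * (t - s)) ->
  absolutely_continuous a b h.
Proof.
(* [M] may be zero or negative, while [e / M'] needs a positive divisor. *)
move=> hM e e0; pose M' := `|M| + 1.
have M'0 : 0 < M' by rewrite /M' ltr_pwDr.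
exists (e / M'); first by rewrite divr_gt0.
move=> n l r lr _; rewrite ltr_pdivlMr// mulrC => /(le_lt_trans _); apply.
rewrite mulr_sumr; apply: ler_sum => i _; have [al [lr' rb]] := lr i.
apply: le_trans (hM _ _ al lr' rb) _; rewrite ler_wpM2r ?subr_ge0//.
by rewrite (le_trans (ler_norm _))// /M' lerDl.
Qed.

Lemma absolutely_continuousN a b h :
  absolutely_continuous a b h -> absolutely_continuous a b (fun t => - h t).
Proof.
move=> ach e /ach[d d0 H]; exists d => // n l r lr tI rld.
rewrite (eq_bigr (fun i => `|h (r i) - h (l i)|)); first exact: H.
by move=> i _; rewrite -opprD normrN.
Qed.

Lemma absolutely_continuousD a b h1 h2 :
  absolutely_continuous a b h1 -> absolutely_continuous a b h2 ->
  absolutely_continuous a b (fun t => h1 t + h2 t).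
Proof.
move=> ac1 ac2 e e0; have e20 : 0 < e / 2 by rewrite divr_gt0.
have [d1 d10 H1] := ac1 _ e20; have [d2 d20 H2] := ac2 _ e20.
exists (Order.min d1 d2); first by rewrite lt_min d10.
move=> n l r lr tI; rewrite lt_min => /andP[rl1 rl2].
have := H1 n l r lr tI rl1; have := H2 n l r lr tI rl2 => s2 s1.
rewrite [ltRHS]splitr; apply: le_lt_trans (ltrD s1 s2).
rewrite -big_split/=; apply: ler_sum => i _.
by rewrite opprD addrACA ler_normD.
Qed.

Lemma absolutely_continuousB a b h1 h2 :
  absolutely_continuous a b h1 -> absolutely_continuous a b h2 ->
  absolutely_continuous a b (fun t => h1 t - h2 t).
Proof.
by move=> ac1 ac2; apply: absolutely_continuousD => //;
   exact: absolutely_continuousN.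
Qed.

Lemma absolutely_continuous_modulus a b h : absolutely_continuous a b h ->
  forall e, 0 < e -> exists2 d : R, 0 < d & forall s t, a <= s -> s <= t ->
    t <= b -> t - s < d -> `|h t - h s| < e.
Proof.
move=> ach e /ach[d d0 H]; exists d => // s t as_ st tb std.
have := H 1%N (fun=> s) (fun=> t); rewrite !big_ord1; apply => //.
by move=> i j; rewrite (ord1 i) (ord1 j).
Qed.

Lemma absolutely_continuous_within a b h :
  absolutely_continuous a b h -> {within `[a, b], continuous h}.
Proof.
move=> /absolutely_continuous_modulus ach; apply/subspace_continuousP => x.
rewrite /= in_itv/= => /andP[ax xb]; apply/cvgrPdist_lt => e /ach[d d0 H].
apply/nbhs_ballP; exists d => //= y; rewrite /ball/= ltr_distl => /andP[yx xy].
rewrite in_itv/= => /andP[ay yb].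
have [xy'|yx'] := leP x y; first by rewrite distrC; apply: H => //; lra.
by apply: H => //; lra.
Qed.

(** The bounds are assumed here; compactness supplies them in [absolutely_continuousM]. *)
Lemma bounded_absolutely_continuousM a b h1 h2 (M : R) :
  (forall t, a <= t <= b -> `|h1 t| <= M) ->
  (forall t, a <= t <= b -> `|h2 t| <= M) ->
  absolutely_continuous a b h1 -> absolutely_continuous a b h2 ->
  absolutely_continuous a b (fun t => h1 t * h2 t).
Proof.
move=> hM1 hM2 ac1 ac2 e e0.
pose M' := `|M| + 1.
have M'0 : 0 < M' by rewrite /M' ltr_pwDr.
have MM' : M <= M' by rewrite (le_trans (ler_norm _))// /M' lerDl.
have e20 : 0 < e / M' / 2 by rewrite !divr_gt0.
have [d1 d10 H1] := ac1 _ e20; have [d2 d20 H2] := ac2 _ e20.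
exists (Order.min d1 d2); first by rewrite lt_min d10.
move=> n l r lr tI; rewrite lt_min => /andP[rl1 rl2].
have := H1 n l r lr tI rl1; have := H2 n l r lr tI rl2 => s2 s1.
have : M' * (\sum_(i < n) `|h1 (r i) - h1 (l i)| +
             \sum_(i < n) `|h2 (r i) - h2 (l i)|) < e.
  by rewrite mulrC -ltr_pdivlMr// [ltRHS]splitr ltrD.
apply: le_lt_trans; rewrite -big_split mulr_sumr/=; apply: ler_sum => i _.
have [al [lr' rb]] := lr i.
have -> : h1 (r i) * h2 (r i) - h1 (l i) * h2 (l i) =
  h2 (r i) * (h1 (r i) - h1 (l i)) + h1 (l i) * (h2 (r i) - h2 (l i)).
  by ring.
rewrite (le_trans (ler_normD _ _))// !normrM mulrDr lerD// ler_wpM2r//.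
  by rewrite (le_trans _ MM')// hM2// rb (le_trans al).
by rewrite (le_trans _ MM')// hM1// al (le_trans lr').
Qed.

End absolutely_continuous_facts.

(** * Absolutely continuous functions with derivative zero almost everywhere *)

Section absolutely_continuous_FTC.
Context {R : realType}.
Notation mu := (@lebesgue_measure R).
Implicit Types (a b : R) (h : R -> R).

(** The Caratheodory slope function is continuous at [c] with value 0, so it is below [e] near [c];
    the point [z = c] needs no separate case. *)
Lemma is_derive0_small_slope h (c e : R) : is_derive c (1 : R) h 0 -> 0 < e ->
  exists2 eta : R, 0 < eta &
    forall z, `|z - c| < eta -> `|h z - h c| <= e * `|z - c|.
Proof.
move=> /is_derive1_caratheodory[q [hq cq q0]] e0.
have /cvgrPdist_lt/(_ _ e0)/nbhs_ballP[eta /= eta0 H] := cq.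
exists eta => // z zc; rewrite hq normrM ler_wpM2r//.
have /= := H z; rewrite q0 sub0r normrN => /(_ _)/ltW; apply.
by rewrite /ball/= distrC.
Qed.

(** Outer regularity of Lebesgue measure, applied to a measurable null set containing [N]. *)
Lemma negligible_open_cover (N : set R) (d : R) : mu.-negligible N -> 0 < d ->
  exists U : set R, [/\ open U, N `<=` U & (mu U < d%:E)%E].
Proof.
move=> [A [mA A0 NA]] d0.
have Afin : (mu A < +oo)%E by rewrite A0.
have [U [oU AU UA]] := lebesgue_regularity_outer mA Afin d0.
exists U; split => //; first exact: subset_trans AU.
rewrite -(setDUK AU) measureU//=.
- by rewrite A0 add0e.
- by apply: measurableD => //; exact: open_measurable.
- by rewrite setDE setICA setICr setI0.
Qed.

(* Covering argument by real induction: away from N the slope of h is small,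
   and near a point of N an interval contained in U can be added. *)
Lemma increment_open_cover a b h (N U : set R) (e : R) : a <= b -> 0 < e ->
  open U -> N `<=` U ->
  (forall t, a <= t <= b -> ~ N t -> is_derive t (1 : R) h 0) ->
  exists n (l r : nat -> R),
    [/\ forall i, (i < n)%N -> [/\ a <= l i, l i <= r i & r i <= b],
        forall i, (i < n)%N -> `]l i, r i[ `<=` U,
        forall i j, (i < j < n)%N -> r i <= l j &
        `|h b - h a| <= e * (b - a) + \sum_(i < n) `|h (r i) - h (l i)|].
Proof.
move=> ab e0 oU NU dh.
pose G x := exists n (l r : nat -> R),
    [/\ forall i, (i < n)%N -> [/\ a <= l i, l i <= r i & r i <= x],
        forall i, (i < n)%N -> `]l i, r i[ `<=` U,
        forall i j, (i < j < n)%N -> r i <= l j &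
        `|h x - h a| <= e * (x - a) + \sum_(i < n) `|h (r i) - h (l i)|].
apply: (@real_induction _ a b G ab).
  exists 0%N, (fun=> a), (fun=> a); split => //.
  by rewrite !subrr normr0 mulr0 big_ord0 addr0.
move=> c /andP[ac cb].
have [Nc|Nc] := pselect (N c); last first.
  (* Outside [N] the slope bound covers both increments, from [x] to [c] and from [c] to [y], and no
     interval is added. *)
  have [eta eta0 H] := is_derive0_small_slope (dh c (introT andP (conj ac cb)) Nc) e0.
  exists eta => // x y /andP[ax xc] /andP[cy yb] cx yc [n [l [r [lr lrU rl hx]]]].
  exists n, l, r; split => //.
    by move=> i /lr[? ? ?]; split => //; lra.
  have h1 : `|h y - h c| <= e * (y - c).
    have := H y; rewrite (_ : `|y - c| = y - c); last by rewrite ger0_norm//; lra.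
    by apply; lra.
  have h2 : `|h c - h x| <= e * (c - x).
    rewrite distrC; have := H x.
    rewrite (_ : `|x - c| = c - x); last by rewrite ler0_norm ?opprB//; lra.
    by apply; lra.
  have -> : h y - h a = (h y - h c) + ((h c - h x) + (h x - h a)) by ring.
  have -> : e * (y - a) = e * (y - c) + (e * (c - x) + e * (x - a)) by ring.
  rewrite (le_trans (ler_normD _ _))// -2!(addrA (e * _)) lerD//.
  by rewrite (le_trans (ler_normD _ _))// lerD.
have /nbhs_ballP[eta /= eta0 etaU] : nbhs c U.
  by apply: open_nbhs_nbhs; split => //; exact: NU.
exists eta => // x y /andP[ax xc] /andP[cy yb] cx yc [n [l [r [lr lrU rl hx]]]].
(* The new interval []x, y[] stays within [eta] of [c], hence in [U]. Placed last, it keeps the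
   intervals ordered, and the sum absorbs the increment of [h]. *)
exists n.+1, (fun i => if (i < n)%N then l i else x),
             (fun i => if (i < n)%N then r i else y); split.
- move=> i; rewrite ltnS leq_eqVlt => /orP[/eqP->|i_n].
    by rewrite ltnn; split => //; lra.
  by rewrite i_n; have [? ? ?] := lr _ i_n; split => //; lra.
- move=> i; rewrite ltnS leq_eqVlt => /orP[/eqP->|i_n];
    last by rewrite i_n; exact: lrU.
  rewrite ltnn => z /=; rewrite in_itv/= => /andP[xz zy]; apply: etaU.
  by rewrite /ball/= ltr_distl; apply/andP; split; lra.
- move=> i j /andP[ij]; rewrite ltnS leq_eqVlt => /orP[/eqP jn|j_n].
    by rewrite jn ltnn -jn ij; have [_ _ rx] := lr i ltac:(by rewrite -jn).
  by rewrite j_n (ltn_trans ij j_n); apply: rl; rewrite ij.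
- rewrite big_ord_recr/= ltnn.
  under eq_bigr => i _ do rewrite ltn_ord.
  have -> : h y - h a = (h x - h a) + (h y - h x) by ring.
  rewrite (le_trans (ler_normD _ _))// addrA lerD2r (le_trans hx)// lerD2r.
  by rewrite ler_wpM2l ?(ltW e0)//; lra.
Qed.

(** Cover the exceptional null set by an open set of small measure. The increment of [h] is bounded
    by a small-slope part plus a sum over disjoint intervals of small total length, which absolute
    continuity controls; each is at most [e / 2]. *)
Lemma absolutely_continuous_derive0 a b h : a <= b ->
  absolutely_continuous a b h ->
  {ae mu, forall t, `]a, b[%classic t -> is_derive t (1 : R) h 0} ->
  h b = h a.
Proof.
move=> ab ach dh; apply/eqP; rewrite -subr_eq0 -normr_le0.
apply/ler_addgt0Pr => e e0; rewrite add0r.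
(* The endpoints join the exceptional set because the derivative is known only inside the
   interval. *)
pose N := ([set a] `|` [set b]) `|`
  ~` [set t | `]a, b[%classic t -> is_derive t (1 : R) h 0].
have negN : mu.-negligible N.
  by apply: negligibleU => //; apply: negligibleU;
     apply/negligibleP => //; exact: lebesgue_measure_set1.
have e20 : 0 < e / 2 by rewrite divr_gt0.
have [d d0 Hd] := ach _ e20.
have [U [oU NU Ud]] := negligible_open_cover negN d0.
(* Adding 1 keeps the divisor positive when [a = b]. *)
have e30 : 0 < e / 2 / (b - a + 1) by rewrite divr_gt0//; lra.
have [|n [l [r [lr lrU rl hab]]]] := @increment_open_cover a b h N U _ ab e30 oU NU.
  move=> t /andP[at_ tb] Nt; apply: contrapT => ht; apply: (Nt).
  left; apply: contrapT => tab; apply: Nt => //=; right => H; apply: ht.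
  apply: H; rewrite /= in_itv/= !lt_neqAle at_ tb !andbT; apply/andP; split.
    by apply/eqP => ta; apply: tab; left.
  by apply/eqP => ta; apply: tab; right.
have tI : trivIset setT (fun i : 'I_n => `]l i, r i[%classic).
  apply/trivIsetP => i j _ _; wlog ij : i j / (i < j)%N.
    move=> H ij; have [ij'|] := ltnP i j; first exact: H.
    rewrite leq_eqVlt => /orP[/eqP/val_inj ji|ji]; first by rewrite ji eqxx in ij.
    by rewrite setIC; apply: H => //; rewrite eq_sym.
  move=> _; apply/seteqP; split => // z [/=]; rewrite !in_itv/=.
  by have := rl i j; rewrite ij ltn_ord => /(_ isT); lra.
have : \sum_(i < n) `|h (r i) - h (l i)| < e / 2.
  apply: (Hd n l r) => // [i|]; first by have [] := lr i (ltn_ord i).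
  (* The disjoint intervals lie in [U], so their total length is at most its measure. *)
  rewrite -lte_fin; apply: le_lt_trans Ud.
  have -> : ((\sum_(i < n) (r i - l i))%:E =
     mu (\big[setU/set0]_(i < n) `]l i, r i[%classic))%E.
    rewrite measure_bigsetU_ord//= -sumEFin; apply: eq_bigr => i _.
    have [_ li _] := lr i (ltn_ord i).
    rewrite lebesgue_measure_itv/= lte_fin; case: ltP => //.
    by move=> ri; rewrite (_ : r i = l i) ?subrr//; apply/eqP; rewrite eq_le ri.
  apply: le_measure; rewrite ?inE//.
  - by apply: bigsetU_measurable => i _.
  - exact: open_measurable.
  - by rewrite -bigcup_seq => z [i _]; apply: lrU.
have : e / 2 / (b - a + 1) * (b - a) <= e / 2.
  rewrite -mulrA ler_piMr ?(ltW e20)// mulrC ler_pdivrMr; lra.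
lra.
Qed.

End absolutely_continuous_FTC.

Lemma integrable_subT d (T : measurableType d) (R : realType)
  (mu : {measure set T -> \bar R}) (A : set T) (k : T -> \bar R) :
  measurable A -> mu.-integrable setT k -> mu.-integrable A k.
Proof. by move=> mA; apply: integrableS. Qed.

Lemma Rintegral_bigsetU_ord d (T : measurableType d) (R : realType)
  (mu : {measure set T -> \bar R}) (k : T -> R) n (F : 'I_n -> set T) :
  (forall i, measurable (F i)) -> trivIset setT F ->
  mu.-integrable setT (EFin \o k) ->
  \int[mu]_(x in \big[setU/set0]_(i < n) F i) k x =
  \sum_(i < n) \int[mu]_(x in F i) k x.
Proof.
move=> mF tF ik; rewrite /Rintegral.
rewrite (@integral_bigsetU_EFin _ _ _ mu _ F k)//.
- rewrite sum_fine// => i _; apply: integrable_fin_num; first exact: mF.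
  exact: integrable_subT.
- exact: index_enum_uniq.
- exact: sub_trivIset tF.
- apply: measurable_funS (measurable_int _ ik) => //.
Qed.

(** * Fundamental theorem of calculus for absolutely continuous functions *)

Section FTC_absolutely_continuous.
Context {R : realType}.
Notation mu := (@lebesgue_measure R).
Implicit Types (a b : R) (h k : R -> R).

(** The integral of [|k|] over a set of small measure is small; here the set is the union of the
    given intervals. *)
Lemma absolutely_continuous_integral a b k :
  mu.-integrable setT (EFin \o k) ->
  absolutely_continuous a b (fun x => \int[mu]_(t in `]-oo, x]) k t).
Proof.
move=> ik e /(integral_normr_continuous ik)[d [d0 Hd]].
have nik := integrable_norm ik.
exists d => // n l r lr tI rld.
set U := \big[setU/set0]_(i < n) `]l i, r i[%classic.
have mU : measurable U by apply: bigsetU_measurable => i _.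
have muU : (mu U < d%:E)%E.
  rewrite /U measure_bigsetU_ord//=.
  move: rld; rewrite -lte_fin; apply: le_lt_trans; rewrite -sumEFin.
  apply: lee_sum => i _; rewrite lebesgue_measure_itv/= lte_fin.
  have [_ [li _]] := lr i.
  by case: ifP => //; rewrite lee_fin subr_ge0.
apply: le_lt_trans (Hd _ mU muU).
rewrite Rintegral_bigsetU_ord//; apply: ler_sum => i _.
have [_ [li _]] := lr i.
rewrite Rintegral_itvB//; last exact: integrable_subT.
apply: le_trans (le_normr_Rintegral _ _) _ => //; first exact: integrable_subT.
rewrite -Rintegral_itv_bndo_bndc//; exact: integrable_subT.
Qed.

(** By Lebesgue differentiation the indefinite integral of [k] has derivative [k] almost everywhere,
    so [h] minus this integral has derivative zero almost everywhere and takes equal values at [a]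
    and [b]. *)
Theorem absolutely_continuous_FTC a b h k : a <= b ->
  absolutely_continuous a b h -> mu.-integrable `]a, b[ (EFin \o k) ->
  {ae mu, forall t, `]a, b[%classic t -> is_derive t (1 : R) h (k t)} ->
  h b - h a = \int[mu]_(t in `]a, b[) k t.
Proof.
move=> ab ach ik dh.
pose k0 := k \_ `]a, b[.
have ik0 : mu.-integrable setT (EFin \o k0).
  by move: ik; rewrite integrable_mkcond//= (restrict_EFin k).
pose K x := \int[mu]_(t in `]-oo, x]) k0 t.
have dK : {ae mu, forall x, derivable K x 1 /\ derive1 K x = k0 x}.
  apply: FTC1Ny.
    by move=> y; apply: integrable_subT.
  by apply: open_integrable_locally => //; exact: openT.
have acK : absolutely_continuous a b K by exact: absolutely_continuous_integral.
have : h b - K b = h a - K a.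
  apply: (@absolutely_continuous_derive0 R a b (fun t => h t - K t)) => //.
    exact: absolutely_continuousB.
  apply: (@filterS2 _ _ (ae_filter_ringOfSetsType mu) _ _ _ _ dh dK).
  move=> t dht [dKt Kt] tab.
  have {dht} := dht tab => dht.
  have K't : is_derive t (1 : R) K (k t).
    split => //; rewrite -derive1E Kt /k0 patchE mem_set//.
  rewrite -(subrr (k t)); exact: is_deriveB.
move=> hK; have -> : h b - h a = K b - K a by lra.
rewrite /K Rintegral_itvB//; last exact: integrable_subT.
rewrite -Rintegral_itv_bndo_bndc; last exact: integrable_subT.
by apply: eq_Rintegral => t tab; rewrite /k0 patchE tab.
Qed.

End FTC_absolutely_continuous.

(** * Calculus on the real line *)

Section calculus.
Context {R : realType}.
Notation mu := (@lebesgue_measure R).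
Implicit Types (a b : R) (h k : R -> R).

Lemma is_derive_continuous h (t l : R) :
  is_derive t (1 : R) h l -> {for t, continuous h}.
Proof.
by move=> [dh _]; apply/differentiable_continuous/derivable1_diffP.
Qed.

Lemma is_derive_add h k (t dh dk : R) :
  is_derive t (1 : R) h dh -> is_derive t (1 : R) k dk ->
  is_derive t (1 : R) (fun s => h s + k s) (dh + dk).
Proof. exact: is_deriveD. Qed.

Lemma is_derive_sub h k (t dh dk : R) :
  is_derive t (1 : R) h dh -> is_derive t (1 : R) k dk ->
  is_derive t (1 : R) (fun s => h s - k s) (dh - dk).
Proof. exact: is_deriveB. Qed.

Lemma is_derive_mul h k (t dh dk : R) :
  is_derive t (1 : R) h dh -> is_derive t (1 : R) k dk ->
  is_derive t (1 : R) (fun s => h s * k s) (dh * k t + h t * dk).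
Proof.
move=> dhP dkP; rewrite addrC [dh * _]mulrC.
exact: (is_deriveM dhP dkP).
Qed.

Lemma is_derive_MVT h dh a b : a <= b ->
  (forall t, is_derive t (1 : R) h (dh t)) ->
  exists2 c, a <= c <= b & h b - h a = dh c * (b - a).
Proof.
move=> ab dhP; have ch : {within `[a, b], continuous h}.
  by apply: continuous_subspaceT => t; exact: is_derive_continuous.
have [c cab ->] := @MVT_segment R h dh a b ab (fun t _ => dhP t) ch.
by exists c => //; move: cab; rewrite in_itv.
Qed.

Lemma continuous_itv_bounded k a b : {within `[a, b], continuous k} ->
  exists M, forall t, a <= t <= b -> `|k t| <= M.
Proof.
move=> ck.
have /compact_bounded[M [_ mrt]] := continuous_compact ck (@segment_compact _ a b).
exists (M + 1) => t tab; apply: (mrt (M + 1)); first by rewrite ltrDl.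
by exists t => //; rewrite /= in_itv.
Qed.

Lemma absolutely_continuousM a b h1 h2 :
  absolutely_continuous a b h1 -> absolutely_continuous a b h2 ->
  absolutely_continuous a b (fun t => h1 t * h2 t).
Proof.
move=> ac1 ac2.
have [M1 hM1] := continuous_itv_bounded (absolutely_continuous_within ac1).
have [M2 hM2] := continuous_itv_bounded (absolutely_continuous_within ac2).
apply: (@bounded_absolutely_continuousM _ _ _ _ _ (Num.max M1 M2)) => // t tab.
  by rewrite le_max hM1.
by rewrite le_max hM2// orbT.
Qed.

Lemma continuous_segment_integrable k a b :
  {within `[a, b], continuous k} -> mu.-integrable `[a, b] (EFin \o k).
Proof.
by move=> ck; apply: continuous_compact_integrable => //; exact: segment_compact.
Qed.

(** The mean value theorem and a bound of [dh] on the segment give a Lipschitz constant. *)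
Lemma is_derive_absolutely_continuous h dh a b :
  (forall t, is_derive t (1 : R) h (dh t)) -> continuous dh ->
  absolutely_continuous a b h.
Proof.
move=> hP cdh.
have [M hM] := @continuous_itv_bounded dh a b (continuous_subspaceT cdh).
apply: (@absolutely_continuous_lipschitz _ _ _ _ M) => s t as_ st tb.
have [c /andP[sc ct] ->] := is_derive_MVT st hP.
rewrite normrM (ger0_norm (_ : 0 <= t - s)) ?subr_ge0// ler_wpM2r ?subr_ge0//.
by apply: hM; rewrite (le_trans as_ sc) (le_trans ct tb).
Qed.

(** A primitive on the whole line avoids one-sided derivatives at 0. It is built from integrals that
    start at a point [- M] left of both 0 and [t], minus their value at 0. *)
Lemma continuous_antiderivative k : continuous k ->
  exists K : R -> R, [/\ forall t, is_derive t (1 : R) K (k t), K 0 = 0 &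
    forall t, 0 <= t -> K t = \int[mu]_(s in `[0, t]) k s].
Proof.
move=> ck.
have ik a b : mu.-integrable `[a, b] (EFin \o k).
  by apply: continuous_segment_integrable; exact: continuous_subspaceT.
pose J (M t : R) := \int[mu]_(s in `[- M, t]) k s - \int[mu]_(s in `[- M, 0]) k s.
(* The contribution of the points left of [- M] cancels, so the starting point does not matter. *)
have JE M M' t : 0 <= M -> M <= M' -> - M <= t -> J M t = J M' t.
  move=> M0 MM Mt.
  have E x : - M <= x -> \int[mu]_(s in `[- M', x]) k s =
      \int[mu]_(s in `[- M, x]) k s + \int[mu]_(s in `[- M', - M]) k s.
    move=> Mx; apply/eqP; rewrite -subr_eq; apply/eqP.
    rewrite Rintegral_itvB//; last by rewrite bnd_simp lerN2.
    rewrite Rintegral_itv_obnd_cbnd//; apply: integrableS (ik (- M) x) => //.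
    by apply: subset_itvr; rewrite bnd_simp.
  rewrite /J (E t)// (E 0)//; first by ring.
  by rewrite oppr_le0.
pose K t := J (`|t| + 1) t.
have KE M t : `|t| + 1 <= M -> K t = J M t.
  move=> tM; apply: JE => //.
  by have := ler_norm (- t); rewrite normrN; lra.
exists K; split => [t||t t0].
(* [K] picks its starting point according to [t]; the choice [|t| + 2] serves all points within
   distance 1 of [t]. *)
- have [dJ J'] := @continuous_FTC1_closed _ k (- (`|t| + 2)) t (`|t| + 2)
    ltac:(by have := ler_norm t; lra) (ik _ _)
    ltac:(by have := ler_norm (- t); rewrite normrN; lra) (ck t).
  apply: (@near_eq_is_derive _ _ _ (J (`|t| + 2))).
    apply/nbhs_ballP; exists 1 => //= y; rewrite /ball/= => ty.
    apply/esym/KE; have := ler_normD (y - t) t; rewrite subrK distrC; lra.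
  rewrite /J -[k t]subr0; apply: is_deriveB.
  by split => //; rewrite -derive1E.
- by rewrite (KE 1) ?normr0 ?add0r// /J subrr.
- rewrite /K -(JE 0)// ?oppr0//.
  by rewrite /J oppr0 set_itv1 Rintegral_set1 subr0.
Qed.

End calculus.

(** * Square integrable functions *)

Section real_integrable_facts.
Context d (T : measurableType d) (R : realType) (mu : {measure set T -> \bar R}).
Variable (D : set T).
Hypothesis mD : measurable D.
Implicit Types h k : T -> R.

Lemma real_integrableD h k : mu.-integrable D (EFin \o h) ->
  mu.-integrable D (EFin \o k) ->
  mu.-integrable D (EFin \o (fun t => h t + k t)).
Proof. by move=> ih ik; exact: (integrableD mD ih ik). Qed.

Lemma real_integrableZl (c : R) h : mu.-integrable D (EFin \o h) ->
  mu.-integrable D (EFin \o (fun t => c * h t)).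
Proof. by move=> ih; exact: (integrableZl mD c ih). Qed.

Lemma real_integrable_norm h : mu.-integrable D (EFin \o h) ->
  mu.-integrable D (EFin \o (fun t => `|h t|)).
Proof. exact: integrable_norm. Qed.

Lemma real_integrableM h k (M : R) : measurable_fun D h ->
  (forall t, D t -> `|h t| <= M) -> mu.-integrable D (EFin \o k) ->
  mu.-integrable D (EFin \o (fun t => h t * k t)).
Proof.
move=> mh hM ik; apply: (integrableMr mD mh _ ik).
exists M; split; first exact: num_real.
by move=> x Mx t Dt; apply: le_trans (hM t Dt) (ltW Mx).
Qed.

(** Serves uniqueness: comparing costs bounds the integral of a squared difference of controls by
    0. *)
Lemma Rintegral_eq0_ae h : mu.-integrable D (EFin \o h) ->
  (forall t, D t -> 0 <= h t) -> \int[mu]_(t in D) h t <= 0 ->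
  {ae mu, forall t, D t -> h t = 0}.
Proof.
move=> ih h0 Ih0.
have ih0 : (\int[mu]_(t in D) `|(h t)%:E| = 0)%E.
  transitivity (\int[mu]_(t in D) (h t)%:E)%E.
    by apply: eq_integral => t; rewrite inE => Dt; rewrite gee0_abs// lee_fin h0.
  have Ih : (\int[mu]_(t in D) (h t)%:E)%E \is a fin_num.
    exact: integrable_fin_num.
  rewrite -(fineK Ih); congr (_%:E); apply/eqP; rewrite eq_le Ih0/=.
  by apply: fine_ge0; apply: integral_ge0 => t Dt; rewrite lee_fin h0.
have /(_ mD) := @ae_eq_integral_abs _ _ _ mu D.
move=> /(_ (EFin \o h) (measurable_int _ ih)) [/(_ ih0) + _].
apply: (@filterS _ _ (ae_filter_ringOfSetsType mu)) => t /= H Dt.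
by have [] := H Dt.
Qed.

End real_integrable_facts.

Section square_integrable_facts.
Context {R : realType}.
Notation mu := (@lebesgue_measure R).
Implicit Types (a b : R) (u v : R -> R).

Lemma square_integrable_measurable a b u :
  square_integrable `]a, b[ u -> measurable_fun `]a, b[ u.
Proof.
rewrite /square_integrable inE => /andP[]; rewrite inE/= => mu_ _.
by apply/measurable_restrictT.
Qed.

Lemma square_integrable_sqr a b u :
  square_integrable `]a, b[ u -> mu.-integrable `]a, b[ (EFin \o (fun t => u t ^+ 2)).
Proof.
move=> /Lfun2_integrable_sqr iu.
have : mu.-integrable `]a, b[ (EFin \o (fun t => (u \_ `]a, b[) t ^+ 2)).
  exact: integrable_subT.
apply: eq_integrable => // t tab /=; by rewrite patchE tab.
Qed.

Lemma finite_itv_integrable_cst a b (c : R) :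
  mu.-integrable `]a, b[ (EFin \o cst c).
Proof.
have : mu.-integrable `[a, b] (EFin \o cst c); last first.
  by apply: integrableS => //; exact: subset_itv_oo_cc.
apply: continuous_segment_integrable.
by apply: continuous_subspaceT; exact: cst_continuous.
Qed.

(** On a bounded interval [1 + u ^+ 2] is integrable, and it dominates [|u|]. *)
Lemma square_integrable_integrable a b u :
  square_integrable `]a, b[ u -> mu.-integrable `]a, b[ (EFin \o u).
Proof.
move=> squ.
have mab : measurable `]a, b[%classic by exact: measurable_itv.
have i1 : mu.-integrable `]a, b[ (EFin \o (fun t => 1 + u t ^+ 2)).
  apply: real_integrableD => //; first exact: finite_itv_integrable_cst.
  exact: square_integrable_sqr.
apply: (le_integrable _ _ _ i1) => //.
  by apply/measurable_EFinP; exact: square_integrable_measurable.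
move=> t _ /=; rewrite lee_fin (ger0_norm (_ : 0 <= 1 + u t ^+ 2)); last first.
  by rewrite addr_ge0// sqr_ge0.
rewrite -(real_normK (num_real (u t))).
by have := sqr_ge0 (`|u t| - 1); nra.
Qed.

Lemma integrable_square_integrable a b u : measurable_fun `]a, b[ u ->
  mu.-integrable `]a, b[ (EFin \o (fun t => u t ^+ 2)) ->
  square_integrable `]a, b[ u.
Proof.
move=> mu_ iu; rewrite /square_integrable inE; apply/andP; split; rewrite inE/=.
  by apply/(measurable_restrictT _ _).1.
(* The norm is a real power of the integral of the squares, so finiteness of that integral
   suffices. *)
rewrite /finite_norm unlock; apply: poweR_lty.
have /integrableP[_] : mu.-integrable setT (EFin \o ((fun t => u t ^+ 2) \_ `]a, b[)).
  by move: iu; rewrite integrable_mkcond//= (restrict_EFin (fun t => u t ^+ 2)).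
congr (_ < _)%E; apply: eq_integral => t _ /=.
rewrite powR_mulrn// -normrX; congr (`|_|%:E).
by rewrite !patchE; case: ifPn => // _; rewrite expr0n.
Qed.

Lemma continuous_square_integrable a b u : {within `[a, b], continuous u} ->
  square_integrable `]a, b[ u.
Proof.
move=> cu; have iS k : mu.-integrable `[a, b] (EFin \o k) ->
    mu.-integrable `]a, b[ (EFin \o k).
  by apply: integrableS => //; exact: subset_itv_oo_cc.
apply: integrable_square_integrable.
  by have /measurable_int/measurable_EFinP := iS _ (continuous_segment_integrable cu).
apply: iS; apply: continuous_segment_integrable => t.
by have := continuousM (cu t) (cu t); apply: cvg_trans.
Qed.

Lemma square_integrableB a b u v : square_integrable `]a, b[ u ->
  square_integrable `]a, b[ v -> square_integrable `]a, b[ (fun t => u t - v t).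
Proof.
move=> squ sqv; rewrite /square_integrable.
have -> : (fun t => u t - v t) \_ `]a, b[ = u \_ `]a, b[ - v \_ `]a, b[.
  by apply/funext => t; rewrite !(patchE, fctE); case: ifP; rewrite ?subr0.
have [_ addL] := @Lfun_addr_closed _ _ R mu 2%:E (lee1n 2).
have oppL := @Lfun_oppr_closed _ _ R mu 2%:E.
exact: addL squ (oppL _ sqv).
Qed.

End square_integrable_facts.

(** * The control problem *)

Section state_equation.
Context {R : realType}.
Notation mu := (@lebesgue_measure R).
Variables (f g F : R -> R) (alpha T : R).
Hypothesis cf : continuous f.
Hypothesis dF : forall t, is_derive t (1 : R) F (f t * F t).
Hypothesis F_gt0 : forall t, 0 < F t.

Let cF : continuous F.
Proof. by move=> t; exact: is_derive_continuous. Qed.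

Let is_derive_invF t : is_derive t (1 : R) (fun s => (F s)^-1) (- f t / F t).
Proof.
have H := is_deriveV (lt0r_neq0 (F_gt0 t)) (dF t).
apply: (is_derive_eq H); rewrite /GRing.scale/=.
by field; rewrite lt0r_neq0.
Qed.

(** Dividing the difference of two states by [F] cancels every term with [f]. *)
Lemma is_derive_scaled_difference (u v y z : R -> R) (t : R) :
  is_derive t (1 : R) y (f t * y t + g t * u t) ->
  is_derive t (1 : R) z (f t * z t + g t * v t) ->
  is_derive t (1 : R) (fun s => (z s - y s) / F s) (g t / F t * (v t - u t)).
Proof.
move=> dy dz.
have H := is_derive_mul (is_derive_sub dz dy) (is_derive_invF t).
apply: (is_derive_eq H).
by field; rewrite lt0r_neq0.
Qed.

Lemma absolutely_continuous_scaled_difference (y z : R -> R) (a b : R) :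
  absolutely_continuous a b y -> absolutely_continuous a b z ->
  absolutely_continuous a b (fun s => (z s - y s) / F s).
Proof.
move=> acy acz; apply: absolutely_continuousM; first exact: absolutely_continuousB.
apply: is_derive_absolutely_continuous is_derive_invF _ => t.
apply: cvgM; first by apply: cvgN; exact: cf.
by apply: cvgV; [rewrite lt0r_neq0|exact: cF].
Qed.

Lemma ae_derive_scaled_difference (u v y z : R -> R) :
  admissible f g alpha T u y -> admissible f g alpha T v z ->
  {ae mu, forall t, `]0, T[%classic t ->
    is_derive t (1 : R) (fun s => (z s - y s) / F s) (g t / F t * (v t - u t))}.
Proof.
move=> [_ _ _ dy _] [_ _ _ dz _].
apply: (@filterS2 _ _ (ae_filter_ringOfSetsType mu) _ _ _ _ dy dz).
by move=> t dyt dzt tT; exact: (is_derive_scaled_difference (dyt tT) (dzt tT)).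
Qed.

(** The scaled difference of the states starts at 0 and has derivative zero almost everywhere, so it
    stays 0. *)
Lemma admissible_eq_control (u v y z : R -> R) :
  admissible f g alpha T u y -> admissible f g alpha T v z ->
  {ae mu, forall t, `]0, T[%classic t -> v t = u t} ->
  forall t, 0 <= t <= T -> z t = y t.
Proof.
move=> uy vz vu t /andP[t0 tT].
have := ae_derive_scaled_difference uy vz.
move: uy vz => [_ acy y0 _ _] [_ acz z0 _ _] dq.
have acq := absolutely_continuous_scaled_difference acy acz.
have := @absolutely_continuous_derive0 R 0 t (fun s => (z s - y s) / F s) t0.
have acq' := absolutely_continuousS (lexx 0) tT acq.
move=> /(_ acq').
rewrite y0 z0 subrr mul0r => H; apply/eqP; rewrite -subr_eq0.
have /eqP : (z t - y t) / F t = 0; last first.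
  by rewrite mulf_eq0 invr_eq0 (gt_eqF (F_gt0 t)) orbF.
apply: H.
apply: (@filterS2 _ _ (ae_filter_ringOfSetsType mu) _ _ _ _ dq vu).
move=> s dqs vus /=; rewrite in_itv/= => /andP[s0 st].
have sT : `]0, T[%classic s by rewrite /= in_itv/= s0 (lt_le_trans st).
by have := dqs sT; rewrite vus// subrr mulr0.
Qed.

End state_equation.

(** * Optimality and uniqueness of the explicit control *)

Section optimal_control.
Context {R : realType}.
Notation mu := (@lebesgue_measure R).
Variables (f g F A : R -> R) (alpha T t0 gamma : R).
Hypothesis cf : continuous f.
Hypothesis cg : continuous g.
Hypothesis dF : forall t, is_derive t (1 : R) F (f t * F t).
Hypothesis dA : forall t, is_derive t (1 : R) A (F t).
Hypothesis F_gt0 : forall t, 0 < F t.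
Hypothesis g_gt0 : forall t, 0 < g t.
Hypothesis w_noninc :
  forall s t, 0 <= s -> s <= t -> g t / F t <= g s / F s.
Hypothesis t0_gt0 : 0 < t0.
Hypothesis t0T : t0 < T.
Hypothesis gamma_gt0 : 0 < gamma.
Hypothesis F0 : F 0 = 1.

Definition weight (t : R) : R := g t / F t.

(* The adjoint state times the integrating factor: its derivative [dcostate] is
   gamma * F times a subgradient of the absolute value at the optimal state. *)
Definition costate (t : R) : R :=
  (weight t0)^-1 + gamma * (A t0 - A (Num.min t t0)).

Definition dcostate (t : R) : R := if t < t0 then - gamma * F t else 0.

(** For [0 <= t] this is the positive part of [weight t * costate t - 1]: freezing the weight at
    [t0] makes the product equal to 1 afterwards. *)
Definition control (t : R) : R := weight (Num.min t t0) * costate t - 1.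

Let cF : continuous F.
Proof. by move=> t; exact: is_derive_continuous. Qed.

Let cA : continuous A.
Proof. by move=> t; exact: is_derive_continuous. Qed.

Let cmin : continuous (fun t : R => Num.min t t0).
Proof. by move=> t; apply: continuous_min; [exact: cvg_id|exact: cvg_cst]. Qed.

Let continuous_weight : continuous weight.
Proof.
move=> t; apply: cvgM; first exact: cg.
by apply: cvgV; [rewrite lt0r_neq0|exact: cF].
Qed.

Let continuous_costate : continuous costate.
Proof.
move=> t; apply: cvgD; first exact: cvg_cst.
apply: cvgM; first exact: cvg_cst.
apply: cvgB; first exact: cvg_cst.
by apply: (@continuous_comp _ _ _ (fun t : R => Num.min t t0) A);
  [exact: cmin|exact: cA].
Qed.

Lemma continuous_control : continuous control.
Proof.
move=> t; apply: cvgB; last exact: cvg_cst.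
apply: cvgM; last exact: continuous_costate.
apply: (@continuous_comp _ _ _ (fun t : R => Num.min t t0) weight); first exact: cmin.
exact: continuous_weight.
Qed.

Let weight_gt0 t : 0 < weight t.
Proof. by rewrite divr_gt0. Qed.

Let costate_le t : t <= t0 -> costate t = (weight t0)^-1 + gamma * (A t0 - A t).
Proof. by move=> tt; rewrite /costate min_l. Qed.

Let costate_ge t : t0 <= t -> costate t = (weight t0)^-1.
Proof. by move=> tt; rewrite /costate min_r// subrr mulr0 addr0. Qed.

Let A_nondec s t : s <= t -> A s <= A t.
Proof.
move=> st; rewrite -subr_ge0; have [c _ ->] := is_derive_MVT st dA.
by rewrite mulr_ge0 ?subr_ge0// ltW.
Qed.

Lemma control_before t : t <= t0 -> control t = weight t * costate t - 1.
Proof. by move=> tt; rewrite /control min_l. Qed.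

Lemma control_after t : t0 <= t -> control t = 0.
Proof.
by move=> tt; rewrite /control min_r// costate_ge// mulfV ?subrr// lt0r_neq0.
Qed.

(** Before [t0] the ratio [weight t / weight t0] is at least 1 by monotonicity, and the other term
    of the costate contributes a nonnegative amount. *)
Lemma control_ge0 t : 0 <= t -> 0 <= control t.
Proof.
move=> t0'; have [tt|/ltW tt] := leP t t0; last by rewrite control_after.
rewrite control_before// subr_ge0 costate_le//.
rewrite mulrDr -[leLHS]addr0 lerD//.
  by rewrite -ler_pdivrMr ?invr_gt0// invrK mul1r; exact: w_noninc.
apply: mulr_ge0; first exact/ltW/weight_gt0.
by apply: mulr_ge0; [exact: ltW|rewrite subr_ge0 A_nondec].
Qed.

(** The costate has a corner at [t0], so a Lipschitz bound is used, with a bound of [F] on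
    [[0, t0]]. *)
Lemma absolutely_continuous_costate : absolutely_continuous 0 T costate.
Proof.
have [M hM] := @continuous_itv_bounded _ F 0 t0 (continuous_subspaceT cF).
apply: (@absolutely_continuous_lipschitz _ _ _ _ (gamma * M)) => s t s0 st tT.
have [ss|ss] := leP t0 s.
  rewrite !costate_ge ?(le_trans ss st)// subrr normr0.
  apply: mulr_ge0; last by rewrite subr_ge0.
  apply: mulr_ge0; first exact: ltW.
  by apply: le_trans (hM 0 _); rewrite ?lexx /= ?(ltW t0_gt0).
rewrite /costate (min_l (ltW ss)).
set m := Num.min t t0.
have sm : s <= m by rewrite le_min st ltW.
have mt : m <= t by rewrite ge_min lexx.
have mt0 : m <= t0 by rewrite ge_min lexx orbT.
have -> : (weight t0)^-1 + gamma * (A t0 - A m) -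
  ((weight t0)^-1 + gamma * (A t0 - A s)) = - (gamma * (A m - A s)) by ring.
have [c /andP[sc cm] ->] := is_derive_MVT sm dA.
rewrite normrN -mulrA normrM gtr0_norm// ler_pM2l// normrM.
have FM : `|F c| <= M by apply: hM; rewrite (le_trans s0 sc) (le_trans cm).
by rewrite ler_pM// ger0_norm ?subr_ge0// lerD2r.
Qed.

Lemma is_derive_costate t : t != t0 -> is_derive t (1 : R) costate (dcostate t).
Proof.
rewrite neq_lt /dcostate => /orP[tt|tt].
  rewrite tt; apply: (@near_eq_is_derive _ _ _
    (fun s => (weight t0)^-1 + gamma * (A t0 - A s))).
    by apply: filterS (lt_nbhsl tt) => s st; rewrite costate_le// ltW.
  have H := is_derive_add (is_derive_cst (weight t0)^-1 t (1 : R))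
    (is_derive_mul (is_derive_cst gamma t (1 : R))
      (is_derive_sub (is_derive_cst (A t0) t (1 : R)) (dA t))).
  by apply: (is_derive_eq H) => /=; ring.
rewrite ltNge (ltW tt)/=.
apply: (@near_eq_is_derive _ _ _ (cst (weight t0)^-1)).
  have nt : nbhs t [set s | t0 < s].
    by apply: open_nbhs_nbhs; split => //; exact: open_gt.
  by apply: filterS nt => s /= st; rewrite costate_ge// ltW.
Qed.

Variable Z : R -> R.
Hypothesis dZ : forall t, is_derive t (1 : R) Z (weight t * control t).
Hypothesis Z0 : Z 0 = 0.
Hypothesis Zt0 : alpha + Z t0 = 0.

(** Variation of constants; [Zt0] makes the state reach 0 at [t0]. *)
Definition state (t : R) : R := F t * (alpha + Z t).

Lemma state_after t : t0 <= t -> state t = 0.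
Proof.
move=> tt; rewrite /state.
have [c /andP[tc _] ZE] := is_derive_MVT tt dZ.
have {}ZE : Z t = Z t0.
  by apply/eqP; rewrite -subr_eq0 ZE control_after// mulr0 mul0r.
by rewrite ZE Zt0 mulr0.
Qed.

(** On [[0, t0]], [alpha + Z t] equals [Z t - Z t0], and [Z] is nondecreasing because the control is
    nonnegative. *)
Lemma state_le0 t : 0 <= t -> state t <= 0.
Proof.
move=> t_ge0; have [tt|/ltW tt] := leP t t0; last by rewrite state_after.
rewrite /state pmulr_rle0// -Zt0 lerD2l -subr_ge0.
have [c /andP[tc _] ->] := is_derive_MVT tt dZ.
apply: mulr_ge0; last by rewrite subr_ge0.
by apply: mulr_ge0; [exact/ltW/weight_gt0|exact/control_ge0/(le_trans t_ge0)].
Qed.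

Lemma is_derive_state t :
  is_derive t (1 : R) state (f t * state t + g t * control t).
Proof.
have H := is_derive_mul (dF t)
  (is_derive_add (is_derive_cst alpha t (1 : R)) (dZ t)).
apply: (is_derive_eq H); rewrite /cst add0r /state /weight.
by field; rewrite lt0r_neq0.
Qed.

Lemma admissible_control : admissible f g alpha T control state.
Proof.
split.
- exact/continuous_square_integrable/continuous_subspaceT/continuous_control.
- apply: is_derive_absolutely_continuous is_derive_state _ => t.
  apply: cvgD; apply: cvgM; [exact: cf| |exact: cg|exact: continuous_control].
  exact: is_derive_continuous (is_derive_state t).
- by rewrite /state F0 mul1r Z0 addr0.
- by apply: aeW => t _; exact: is_derive_state.
- by rewrite state_after// ltW.
Qed.

Definition running_cost (u y : R -> R) (t : R) : R :=
  2^-1 * `|u t| ^+ 2 + `|u t| + gamma * `|y t|.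

Lemma running_cost_integrable (u y : R -> R) :
  square_integrable `]0, T[ u -> absolutely_continuous 0 T y ->
  mu.-integrable `]0, T[ (EFin \o running_cost u y).
Proof.
move=> squ acy.
have i1 := square_integrable_sqr squ.
have i2 := square_integrable_integrable squ.
have i3 : mu.-integrable `]0, T[ (EFin \o y).
  have cy := absolutely_continuous_within acy.
  apply: (integrableS _ _ _ (continuous_segment_integrable cy)) => //.
  exact: subset_itv_oo_cc.
apply: real_integrableD => //.
  apply: real_integrableD => //; last exact: real_integrable_norm.
  apply: real_integrableZl => //; move: i1; apply: eq_integrable => // t _ /=.
  by rewrite real_normK// num_real.
by apply: real_integrableZl => //; exact: real_integrable_norm.
Qed.

Lemma costE (u y : R -> R) :
  square_integrable `]0, T[ u -> absolutely_continuous 0 T y ->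
  cost T gamma u y = (\int[mu]_(t in `]0, T[) running_cost u y t)%:E.
Proof.
move=> squ acy; rewrite /Rintegral fineK//.
by apply: integrable_fin_num => //; exact: running_cost_integrable.
Qed.

(** The product rule for [costate] times the scaled difference [(z - state) / F]. *)
Definition first_variation (v z : R -> R) (t : R) : R :=
  costate t * (weight t * (v t - control t)) +
  dcostate t * ((z t - state t) / F t).

(** A subgradient inequality: [weight * costate] is a subgradient of the control cost at [control],
    and [dcostate / F] one of [gamma * |y|] at [state]. The quadratic term comes from the strong
    convexity of the control cost. *)
Lemma running_cost_convex (v z : R -> R) (t : R) : 0 <= t ->
  running_cost control state t + first_variation v z t +
    2^-1 * (v t - control t) ^+ 2 <= running_cost v z t.
Proof.
move=> t_ge0; rewrite /running_cost /first_variation /dcostate.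
have wP := weight_gt0 t.
have [tt|tt] := ltP t t0.
  have -> : costate t * (weight t * (v t - control t)) =
      (control t + 1) * (v t - control t).
    by rewrite control_before ?ltW//; ring.
  have -> : - gamma * F t * ((z t - state t) / F t) = - gamma * (z t - state t).
    by field; rewrite lt0r_neq0.
  rewrite (ger0_norm (control_ge0 t_ge0)) (ler0_norm (state_le0 t_ge0)).
  rewrite real_normK ?num_real//.
  have := ler_norm (v t); have := ler_norm (- z t); rewrite normrN => zn vn.
  have := ler_pM2l gamma_gt0 (- z t) `|z t|; rewrite zn => gz.
  rewrite -subr_ge0 [leRHS](_ : _ =
    (`|v t| - v t) + (gamma * `|z t| - gamma * - z t)).
    by rewrite addr_ge0// subr_ge0.
  by field.
(* From [t0] on, control and state are 0 and [weight * costate] is at most 1 by monotonicity, so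
   [|v|] bounds the linear term. *)
rewrite control_after// state_after// costate_ge// normr0 !subr0 expr0n/=.
rewrite real_normK ?num_real// mul0r !mulr0 !addr0 add0r addrC -addrA lerD2l.
rewrite -[leLHS]addr0 lerD//; last by rewrite mulr_ge0// ltW.
rewrite (le_trans (ler_norm _))// mulrA normrM ler_piMl//.
rewrite ger0_norm; last by apply: mulr_ge0; [rewrite invr_ge0|]; exact/ltW/weight_gt0.
by rewrite mulrC ler_pdivrMr// mul1r; apply: w_noninc => //; exact: ltW.
Qed.

(** Each summand is a product of bounded measurable factors and an integrable one; [dcostate] jumps
    at [t0], so its measurability goes through the case distinction. *)
Lemma first_variation_integrable (v z : R -> R) :
  square_integrable `]0, T[ v -> absolutely_continuous 0 T z ->
  mu.-integrable `]0, T[ (EFin \o first_variation v z).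
Proof.
move=> sqv acz; have [sqc acs _ _ _] := admissible_control.
have acq := absolutely_continuous_scaled_difference cf dF F_gt0 acs acz.
have ccq := absolutely_continuous_within acq.
have mc (k : R -> R) : continuous k -> measurable_fun `]0, T[ k.
  move=> ck; apply: subspace_continuous_measurable_fun => //.
  exact: continuous_subspaceT.
have oc t : `]0, T[%classic t -> 0 <= t <= T.
  by rewrite /= in_itv/= => /andP[? ?]; rewrite !ltW.
have [M hM] := @continuous_itv_bounded _ costate 0 T
  (continuous_subspaceT continuous_costate).
have [N hN] := @continuous_itv_bounded _ weight 0 T
  (continuous_subspaceT continuous_weight).
have [L hL] := @continuous_itv_bounded _ F 0 T (continuous_subspaceT cF).
apply: real_integrableD => //.
  apply: (@real_integrableM _ _ _ mu _ _ _ _ M) => //; first exact: mc.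
    by move=> t /oc; exact: hM.
  apply: (@real_integrableM _ _ _ mu _ _ _ _ N) => //; first exact: mc.
    by move=> t /oc; exact: hN.
  exact/square_integrable_integrable/square_integrableB.
apply: (@real_integrableM _ _ _ mu _ _ _ _ (gamma * L)) => //.
- apply/measurable_funTS/measurable_fun_ifT => //.
    by apply: measurable_fun_ltr => //; exact: measurable_cst.
  apply: continuous_measurable_fun => t.
  by apply: cvgM; [exact: cvg_cst|exact: cF].
- move=> t /oc tT; have L0 := le_trans (normr_ge0 _) (hL _ tT).
  rewrite /dcostate; case: ifP => _; last by rewrite normr0 mulr_ge0// ltW.
  by rewrite normrM normrN (gtr0_norm gamma_gt0) (ler_pM2l gamma_gt0) hL.
- by apply: (integrableS _ _ _ (continuous_segment_integrable ccq)).
Qed.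

(** The integrand is almost everywhere the derivative of the costate times the scaled difference,
    which vanishes at 0 and [T] since admissible states share their boundary values. *)
Lemma first_variation_eq0 (v z : R -> R) :
  admissible f g alpha T v z ->
  \int[mu]_(t in `]0, T[) first_variation v z t = 0.
Proof.
move=> vz; have uy := admissible_control.
have dq := ae_derive_scaled_difference dF F_gt0 uy vz.
case: vz uy => sqv acz z0 _ zT [_ acs s0 _ sT].
have acq := absolutely_continuous_scaled_difference cf dF F_gt0 acs acz.
have T0 : 0 <= T by rewrite ltW// (lt_trans t0_gt0).
have acPq := absolutely_continuousM absolutely_continuous_costate acq.
rewrite -(absolutely_continuous_FTC T0 acPq (first_variation_integrable sqv acz)).
  by rewrite zT sT z0 s0 !subrr !mul0r !mulr0 subrr.
(* The corner of the costate is a single point, hence negligible. *)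
have nt0 : {ae mu, forall t, t != t0}.
  exists [set t0]; split => //; first exact: lebesgue_measure_set1.
  by move=> t /= /negP; rewrite negbK => /eqP.
apply: (@filterS2 _ _ (ae_filter_ringOfSetsType mu) _ _ _ _ dq nt0).
move=> t dqt tt0 /dqt dqt'.
have H := is_derive_mul (is_derive_costate tt0) dqt'.
by apply: (is_derive_eq H); rewrite /first_variation addrC.
Qed.

(** Integrates [running_cost_convex]; keeping the quadratic term yields uniqueness along with
    optimality. *)
Lemma cost_gap (v z : R -> R) : admissible f g alpha T v z ->
  \int[mu]_(t in `]0, T[) running_cost control state t +
  2^-1 * \int[mu]_(t in `]0, T[) (v t - control t) ^+ 2 <=
  \int[mu]_(t in `]0, T[) running_cost v z t.
Proof.
move=> vz; have fv0 := first_variation_eq0 vz.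
case: vz => sqv acz z0 _ zT; have [squ acs _ _ _] := admissible_control.
have iu := running_cost_integrable squ acs.
have iv := running_cost_integrable sqv acz.
have ifv := first_variation_integrable sqv acz.
have isq := square_integrable_sqr (square_integrableB sqv squ).
have i1 : mu.-integrable `]0, T[
    (EFin \o (fun t => running_cost control state t + first_variation v z t)).
  exact: real_integrableD.
have i2 : mu.-integrable `]0, T[
    (EFin \o (fun t => 2^-1 * (v t - control t) ^+ 2)).
  exact: real_integrableZl.
have -> : \int[mu]_(t in `]0, T[) running_cost control state t +
    2^-1 * \int[mu]_(t in `]0, T[) (v t - control t) ^+ 2 =
  \int[mu]_(t in `]0, T[) (running_cost control state t +
    first_variation v z t + 2^-1 * (v t - control t) ^+ 2).
  by rewrite RintegralD// RintegralD// fv0 addr0 RintegralZl.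
apply: le_Rintegral => //; first exact: real_integrableD.
move=> t; rewrite /= in_itv/= => /andP[/ltW t_ge0 _].
exact: running_cost_convex.
Qed.

Theorem control_unique_solution :
  OC_unique_solution f g alpha T gamma control state.
Proof.
have uy := admissible_control; have [squ acs _ _ _] := uy.
split.
  split=> // v z vz; have [sqv acz _ _ _] := vz.
  rewrite !costE// lee_fin; apply: le_trans (cost_gap vz).
  rewrite lerDl mulr_ge0//; apply: Rintegral_ge0 => t _; exact: sqr_ge0.
(* Another solution costs no more than the control, so the gap forces the integral of the squared
   difference to be at most 0. *)
move=> v z [vz /(_ _ _ uy)]; have [sqv acz _ _ _] := vz.
rewrite !costE// lee_fin => /(le_trans (cost_gap vz)).
rewrite gerDl pmulr_rle0// => sq0.
have isq := square_integrable_sqr (square_integrableB sqv squ).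
have vu : {ae mu, forall t, `]0, T[%classic t -> v t = control t}.
  have : {ae mu, forall t, `]0, T[%classic t -> (v t - control t) ^+ 2 = 0}.
    by apply: Rintegral_eq0_ae => // t _; exact: sqr_ge0.
  apply: (@filterS _ _ (ae_filter_ringOfSetsType mu)) => t H /H /eqP.
  by rewrite sqrf_eq0 subr_eq0 => /eqP.
split=> //; exact: (admissible_eq_control cf dF F_gt0 uy vz).
Qed.

End optimal_control.

(** * Passage from data on the half-line to data on the whole line *)

Section half_line.
Context {R : realType}.
Notation mu := (@lebesgue_measure R).
Implicit Types (f g dg : R -> R).

Lemma continuous_maxr0 f : {within `[0, +oo[, continuous f} ->
  continuous (fun t : R => f (Num.max t 0)).
Proof.
move=> /subspace_continuousP cf t.
have cm : {for t, continuous (fun t : R => Num.max t 0)}.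
  by apply: continuous_max; [exact: cvg_id|exact: cvg_cst].
have m0 (s : R) : `[0, +oo[%classic (Num.max s 0).
  by rewrite /= in_itv/= andbT le_max lexx orbT.
move=> P /(cf _ (m0 t)) H.
have {}H : \forall s \near t, `[0, +oo[%classic (Num.max s 0) ->
  P (f (Num.max s 0)) by exact: (cm _ H).
by apply: filterS H => s; apply.
Qed.

(** At an interior point of [D] the limit within [D] is the ordinary one; the difference quotient,
    set to [l] at [t], is the Caratheodory slope. *)
Lemma has_derivative_within_is_derive (D : set R) g (t l : R) :
  nbhs t D -> has_derivative_within D g t l -> is_derive t (1 : R) g l.
Proof.
move=> Dt dg; apply/is_derive1_caratheodory.
exists (fun s => if s == t then l else (g s - g t) / (s - t)); split.
- move=> s; case: eqP => [->|/eqP st]; first by rewrite !subrr mulr0.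
  by rewrite divfK// subr_eq0.
- apply/continuous_withinNx; rewrite eqxx => P /dg H.
  have {}H : \forall s \near t, s != t -> D s -> P ((g s - g t) / (s - t)) by exact: H.
  have : \forall s \near t, s != t -> P (if s == t then l else (g s - g t) / (s - t)).
    by apply: filterS2 H Dt => s Hs Ds st; rewrite (negbTE st); exact: Hs.
  by [].
- by rewrite eqxx.
Qed.

(** The equation is imposed only inside []0, T[] and the cost does not mention [f] or [g], so both
    problems have the same admissible pairs. *)
Lemma OC_unique_solution_eq f g f' g' (alpha T gamma : R) (u y : R -> R) :
  (forall t, 0 < t < T -> f t = f' t) -> (forall t, 0 < t < T -> g t = g' t) ->
  OC_unique_solution f' g' alpha T gamma u y ->
  OC_unique_solution f g alpha T gamma u y.
Proof.
move=> ff gg.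
have E : admissible f g alpha T = admissible f' g' alpha T.
  apply/funext => v; apply/funext => z; apply/propext.
  split=> -[sqv acz z0 dz zT]; split => //;
    apply: (@filterS _ _ (ae_filter_ringOfSetsType mu) _ _ _ dz) => t H tT;
    have := H tT; move: tT; rewrite /= in_itv/= => tT; rewrite ff// gg//.
by rewrite /OC_unique_solution /OC_solution E.
Qed.

(** A negative point has a neighbourhood that misses []0, T[], a point beyond [t0] one on which [u]
    is 0. *)
Lemma ess_support_le (T t0 : R) (u : R -> R) :
  (forall t, t0 <= t -> u t = 0) -> ess_support `]0, T[ u `<=` `[0, t0].
Proof.
move=> u0 t ut; rewrite /= in_itv/=; apply/andP; split; rewrite leNgt; apply/negP => tt.
  apply: (ut [set s | s < 0]).
    by apply: open_nbhs_nbhs; split => //; exact: open_lt.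
  by apply: aeW => s; rewrite /= in_itv/= => /andP[s0 _] /(lt_trans s0); rewrite ltxx.
apply: (ut [set s | t0 < s]).
  by apply: open_nbhs_nbhs; split => //; exact: open_gt.
by apply: aeW => s _ /= /ltW; exact: u0.
Qed.

End half_line.

(** * Monotonicity of the weight and the choice of [gamma] *)

Lemma nonincreasing_quotient (R : realType) (f g dg F : R -> R) :
  continuous g -> (forall t : R, 0 < t -> is_derive t (1 : R) g (dg t)) ->
  (forall t, is_derive t (1 : R) F (f t * F t)) -> (forall t, 0 < F t) ->
  (forall t, 0 <= t -> dg t <= f t * g t) ->
  forall s t, 0 <= s -> s <= t -> g t / F t <= g s / F s.
Proof.
move=> cg dgP dF F0 dgle s t s0 st.
pose dw c := (dg c - f c * g c) / F c.
(* Interior points suffice for the mean value theorem, so a corner of the extended [g] at 0 does no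
   harm. *)
have dwP c : c \in `]s, t[ -> is_derive c (1 : R) (fun c => g c / F c) (dw c).
  rewrite in_itv/= => /andP[sc _].
  have H := is_derive_mul (dgP c (le_lt_trans s0 sc))
    (is_deriveV (lt0r_neq0 (F0 c)) (dF c)).
  apply: (is_derive_eq H); rewrite /dw /GRing.scale/=.
  by field; rewrite lt0r_neq0.
have cw : {within `[s, t], continuous (fun c => g c / F c)}.
  apply: continuous_subspaceT => c; apply: cvgM; first exact: cg.
  by apply: cvgV; [rewrite lt0r_neq0|exact: is_derive_continuous].
have [c cst_ E] := MVT_segment st dwP cw.
rewrite -subr_le0 E; apply: mulr_le0_ge0; last by rewrite subr_ge0.
rewrite /dw pmulr_lle0 ?invr_gt0// subr_le0 dgle//.
by move: cst_; rewrite in_itv/= => /andP[/(le_trans s0)].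
Qed.

(** The end value [alpha + Z t0] is affine in [gamma], with a positive slope [B3 t0]; the last
    hypothesis makes its root positive. *)
Lemma exists_control_multiplier (R : realType) (g F A : R -> R) (alpha t0 : R)
    (B1 B2 : R -> R) :
  continuous g -> continuous F ->
  (forall t, 0 < F t) -> (forall t, 0 < g t) ->
  (forall t, is_derive t (1 : R) A (F t)) -> 0 < t0 ->
  (forall t, is_derive t (1 : R) B1 (weight g F t ^+ 2)) -> B1 0 = 0 ->
  (forall t, is_derive t (1 : R) B2 (weight g F t)) -> B2 0 = 0 ->
  0 < - alpha - (weight g F t0)^-1 * B1 t0 + B2 t0 ->
  exists2 gamma, 0 < gamma & forall Z : R -> R,
    (forall t, is_derive t (1 : R) Z (weight g F t * control g F A t0 gamma t)) ->
    Z 0 = 0 -> alpha + Z t0 = 0.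
Proof.
move=> cg cF F0 g0 dA t00 dB1 B10 dB2 B20 hgap.
have cA : continuous A by move=> t; exact: is_derive_continuous.
have cw : continuous (weight g F).
  move=> t; apply: cvgM; first exact: cg.
  by apply: cvgV; [rewrite lt0r_neq0|exact: cF].
have w0 t : 0 < weight g F t by rewrite divr_gt0.
have [|B3 [dB3 B30 _]] :=
    @continuous_antiderivative R (fun t => weight g F t ^+ 2 * (A t0 - A t)).
  move=> t; apply: cvgM; first by apply: cvgM; exact: cw.
  by apply: cvgB; [exact: cvg_cst|exact: cA].
(* [B3 t0] is [t0] times the integrand at an interior point, where [A t0 - A] is positive because
   [F] is. *)
have B3_gt0 : 0 < B3 t0.
  have cB3 : {within `[0, t0], continuous B3}.
    by apply: continuous_subspaceT => t; exact: is_derive_continuous.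
  have [c] := MVT t00 (fun t _ => dB3 t) cB3.
  rewrite in_itv/= B30 !subr0 => /andP[c0 ct] ->.
  apply: mulr_gt0 => //; apply: mulr_gt0; first by rewrite exprn_gt0.
  have [e _ ->] := is_derive_MVT (ltW ct) dA.
  by rewrite mulr_gt0// subr_gt0.
pose gamma := (- alpha - (weight g F t0)^-1 * B1 t0 + B2 t0) / B3 t0.
exists gamma; first by rewrite divr_gt0.
move=> Z dZ Z0.
(* On [[0, t0]] the derivative of [H] is weight times control with the costate written out, so [Z]
   and [H] have the same increment there. *)
pose H t := (weight g F t0)^-1 * B1 t + gamma * B3 t - B2 t.
pose dH t := (weight g F t0)^-1 * weight g F t ^+ 2 +
  gamma * (weight g F t ^+ 2 * (A t0 - A t)) - weight g F t.
have dHP t : is_derive t (1 : R) H (dH t).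
  have D1 := is_derive_mul (is_derive_cst (weight g F t0)^-1 t (1 : R)) (dB1 t).
  have D3 := is_derive_mul (is_derive_cst gamma t (1 : R)) (dB3 t).
  apply: (is_derive_eq (is_derive_sub (is_derive_add D1 D3) (dB2 t))).
  by rewrite /cst /dH; ring.
have [c /andP[_ ct]] := is_derive_MVT (ltW t00)
  (fun t => is_derive_sub (dZ t) (dHP t)).
rewrite control_before// /costate min_l// (_ : _ - dH c = 0);
  last by rewrite /dH; ring.
rewrite mul0r Z0 /H B10 B20 B30 !mulr0 !addr0 !subr0 => /eqP.
rewrite subr_eq0 => /eqP ->; rewrite /gamma divfK ?lt0r_neq0//; ring.
Qed.

Unset Implicit Arguments.
Set Strict Implicit.

Theorem mainTheorem5 (R : realType) (f g dg : R -> R) (alpha T : R)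
    (f_cont : {within `[0, +oo[%classic, continuous f})
    (g_cont : {within `[0, +oo[%classic, continuous g})
    (f_pos : forall t, 0 <= t -> 0 < f t)
    (g_pos : forall t, 0 <= t -> 0 < g t)
    (alpha_neg : alpha < 0)
    (T_pos : 0 < T)
    (g_C1 : C1_on_with `[0, +oo[%classic g dg)
    (dg_le : forall t, 0 <= t -> dg t <= f t * g t) :
  let F := integrating_factor f in
  forall t0 : R, 0 < t0 < T ->
    0 < - alpha
        - F t0 / g t0 *
          (\int[@lebesgue_measure R]_(t in `[0, t0]) (g t ^+ 2 / F t ^+ 2))
        + \int[@lebesgue_measure R]_(t in `[0, t0]) (g t / F t) ->
    exists2 gamma : R, 0 < gamma &
      exists u y : R -> R,
        OC_unique_solution f g alpha T gamma u y /\
        ess_support `]0, T[%classic u `<=` `[0, t0].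
Proof.
move=> F t0 /andP[t00 t0T] hgap.
have [dg0 _] := g_C1.
(* The data are extended to negative [t] by their values at 0, so that [F1] and the primitives below
   are differentiable at every real point. *)
pose f1 (t : R) := f (Num.max t 0); pose g1 (t : R) := g (Num.max t 0).
have f1E t : 0 <= t -> f1 t = f t by move=> ?; rewrite /f1 max_l.
have g1E t : 0 <= t -> g1 t = g t by move=> ?; rewrite /g1 max_l.
have max0 (t : R) : 0 <= Num.max t 0 by rewrite le_max lexx orbT.
have cf1 : continuous f1 by exact: continuous_maxr0.
have cg1 : continuous g1 by exact: continuous_maxr0.
have g1_gt0 t : 0 < g1 t by exact: g_pos.
have [Phi [dPhi Phi0 PhiE]] := continuous_antiderivative cf1.
pose F1 t := expR (Phi t).
have dF1 t : is_derive t (1 : R) F1 (f1 t * F1 t).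
  by rewrite mulrC; exact: is_derive1_comp.
have F1_gt0 t : 0 < F1 t by exact: expR_gt0.
have F10 : F1 0 = 1 by rewrite /F1 Phi0 expR0.
have F1E t : 0 <= t -> F1 t = F t.
  move=> t_ge0; rewrite /F1 PhiE//; congr expR; apply: eq_Rintegral => s.
  by rewrite inE/= in_itv/= => /andP[s0 _]; rewrite f1E.
have cF1 : continuous F1 by move=> t; exact: is_derive_continuous.
have dg1 (t : R) : 0 < t -> is_derive t (1 : R) g1 (dg t).
  move=> t_gt0.
  have nt : nbhs t [set s | 0 < s].
    by apply: open_nbhs_nbhs; split => //; exact: open_gt.
  apply: (@near_eq_is_derive _ _ _ g).
    by apply: filterS nt => s /= /ltW s0; rewrite g1E.
  apply: (@has_derivative_within_is_derive _ `[0, +oo[%classic).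
    by apply: filterS nt => s /= /ltW s0; rewrite in_itv/= s0.
  by apply: dg0; rewrite /= in_itv/= ltW.
have w_noninc : forall s t, 0 <= s -> s <= t -> g1 t / F1 t <= g1 s / F1 s.
  apply: (@nonincreasing_quotient R f1 g1 dg F1) => // t t_ge0.
  by rewrite f1E// g1E// dg_le.
have cw : continuous (weight g1 F1).
  move=> t; apply: cvgM; first exact: cg1.
  by apply: cvgV; [rewrite lt0r_neq0|exact: cF1].
have [A [dA _ _]] := continuous_antiderivative cF1.
have [|B1 [dB1 B10 B1E]] := @continuous_antiderivative R (fun t => weight g1 F1 t ^+ 2).
  by move=> t; apply: cvgM; exact: cw.
have [B2 [dB2 B20 B2E]] := continuous_antiderivative cw.
(* The assumption on [t0] in terms of the weight: [F / g] is its inverse and [g ^+ 2 / F ^+ 2] its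
   square. *)
have hgap1 : 0 < - alpha - (weight g1 F1 t0)^-1 * B1 t0 + B2 t0.
  have t0_ge0 := ltW t00.
  move: hgap; rewrite B1E// B2E// /weight F1E// g1E// invfM invrK [_^-1 * _]mulrC.
  congr (0 < _ - _ * _ + _); apply: eq_Rintegral => t;
    rewrite inE/= in_itv/= => /andP[t_ge0 _]; rewrite F1E// g1E// expr_div_n//.
have [gamma gamma0 Zt0] := exists_control_multiplier cg1 cF1 F1_gt0 g1_gt0 dA
  t00 dB1 B10 dB2 B20 hgap1.
have [|Z [dZ Z0 _]] := @continuous_antiderivative R
    (fun t => weight g1 F1 t * control g1 F1 A t0 gamma t).
  move=> t; apply: cvgM; first exact: cw.
  exact: (continuous_control cg1 dF1 dA F1_gt0).
exists gamma => //.
exists (control g1 F1 A t0 gamma), (state F1 alpha Z); split.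
  apply: (@OC_unique_solution_eq _ _ _ f1 g1) => [t /andP[/ltW]|t /andP[/ltW]|].
  - by move=> /f1E.
  - by move=> /g1E.
  exact: (control_unique_solution cf1 cg1 dF1 dA F1_gt0 g1_gt0 w_noninc t00 t0T
    gamma0 F10 dZ Z0 (Zt0 Z dZ Z0)).
by apply: ess_support_le => t tt; exact: control_after.
Qed.
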